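(* Let $\gamma$ be a half-area $2n$-polygon. Then the number of indices $i\in\{1,\dots,n\}$ such that $\gamma(i)$ is a half-area vertex of $\gamma$ is odd and at least $3$.
   Context: Indices are taken modulo $2n$. $[A,B]$ denotes the determinant of the $2\times2$ matrix with columns $A,B\in\mathbb{R}^2$. A half-area $2n$-polygon is a convex polygon with $2n$ vertices $\gamma(1),\dots,\gamma(2n)\in\mathbb{R}^2$, listed in cyclic order along its boundary (collinear consecutive vertices are allowed), such that, for every $i$, the line $l(i)$ through the opposite vertices $\gamma(i)$ and $\gamma(i+n)$ divides the polygonal region into two parts of equal area. Put $\gamma'(i+\tfrac12)=\gamma(i+1)-\gamma(i)$ (so $i+\tfrac12$ is just a label for the side from $\gamma(i)$ to $\gamma(i+1)$; the opposite side has label $i+n+\tfrac12$) and $\delta(i+\tfrac12)=[\gamma'(i+\tfrac12),\gamma'(i+n+\tfrac12)]$. The vertex $\gamma(i)$ is a half-area vertex of $\gamma$ if $\delta(i-\tfrac12)\cdot\delta(i+\tfrac12)<0$.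
   Formalization: The formal theorem additionally assumes that no two opposite sides are parallel, i.e. δ(i+1/2) ≠ 0 for every i; without this the claim fails, e.g. for the square or the regular hexagon, where every δ is 0 and there are no half-area vertices. *)

(* Defs.v *)
From HB Require Import structures.
From mathcomp Require Import all_boot all_order all_algebra.
From mathcomp Require Import all_classical all_reals all_analysis.
Set Implicit Arguments.
Unset Strict Implicit.
Unset Printing Implicit Defensive.
Import Order.TTheory GRing.Theory Num.Theory.
Import numFieldNormedType.Exports.
Local Open Scope classical_set_scope.
Local Open Scope ring_scope.

(* The 2n vertices are indexed by 'Z_(2 * n), so that index arithmetic is
   modulo 2n (for n >= 1; the library reads 'Z_0 as Z/2Z). *)

Section HalfAreaPolygons.
Variables (R : realType) (n : nat).
Implicit Types (gamma : 'Z_(2 * n) -> R * R) (i j : 'Z_(2 * n)).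

(* [A, B], the determinant of the matrix with columns A and B *)
Definition det2 (A B : R * R) : R := A.1 * B.2 - A.2 * B.1.

(* gamma'(i + 1/2); the half-integer label i + 1/2 is encoded by i *)
Definition side gamma i : R * R := gamma (i + 1) - gamma i.

(* Distinct vertices, not all collinear, such that the line through each side
   supports the polygon, which lies to the left of every directed side
   (counterclockwise listing) or to the right of every directed side
   (clockwise listing). The weak inequalities allow collinear consecutive
   vertices. The common orientation of the sides makes the listing follow the
   boundary, and injectivity makes it go around exactly once. *)
Definition convex_polygon gamma : Prop :=
  [/\ injective gamma,
      exists i j k,
        det2 (gamma j - gamma i) (gamma k - gamma i) != 0
    & (forall i j, 0 <= det2 (side gamma i) (gamma j - gamma i)) \/
      (forall i j, det2 (side gamma i) (gamma j - gamma i) <= 0)].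

(* the polygonal region, i.e. the convex hull of the vertices *)
Definition region gamma : set (R * R) :=
  [set p | exists t : 'Z_(2 * n) -> R,
     [/\ forall i, 0 <= t i, \sum_i t i = 1
       & p = (\sum_i t i * (gamma i).1, \sum_i t i * (gamma i).2)]].

Definition area (A : set (R * R)) : \bar R :=
  (@lebesgue_measure R \x @lebesgue_measure R)%E A.

(* the vertex opposite to gamma i is gamma (i + n) *)
Definition opp i : 'Z_(2 * n) := i + n%:R.

(* the closed half-planes on either side of the line l(i) through gamma i and
   gamma (i + n) *)
Definition left_of_l gamma i : set (R * R) :=
  [set p | 0 <= det2 (gamma (opp i) - gamma i) (p - gamma i)].
Definition right_of_l gamma i : set (R * R) :=
  [set p | det2 (gamma (opp i) - gamma i) (p - gamma i) <= 0].

Definition half_area_polygon gamma : Prop :=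
  convex_polygon gamma /\
  forall i, area (region gamma `&` left_of_l gamma i) =
            area (region gamma `&` right_of_l gamma i).

(* delta(i + 1/2) *)
Definition delta gamma i : R := det2 (side gamma i) (side gamma (opp i)).

Definition half_area_vertex gamma i : bool :=
  delta gamma (i - 1) * delta gamma i < 0.

(* the number of i in {1, ..., n} such that gamma i is a half-area vertex *)
Definition nb_half_area_vertices gamma : nat :=
  #|[set k : 'I_n | half_area_vertex gamma (k.+1)%:R]%SET|.

End HalfAreaPolygons.

(* Main.v *)
Require Import Defs.
From HB Require Import structures.
From mathcomp Require Import all_boot all_order all_algebra.
From mathcomp Require Import all_classical all_reals all_analysis.
From mathcomp Require Import measurable_realfun zify ring lra.
Import Order.TTheory GRing.Theory Num.Theory.
Import numFieldNormedType.Exports.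
Local Open Scope ring_scope.

(** Reversing the listing of the vertices exchanges the two orientations, so
    let the polygon be listed counterclockwise. Write P, Q, S, T for the
    vertices gamma i, gamma (i + 1), gamma (i + n), gamma (i + n + 1).

    The lines PS and QT both halve the region, hence the two opposite sectors
    that they cut off have the same area. These sectors are the triangles XPQ
    and XST, where X is the common point of the lines. Comparing the two areas
    gives [Q - P, T - P] = [T - S, P - S] ([halving_trapezoid]): the
    quadrilateral PQST is a trapezoid, with QS parallel to PT.

    It follows that the midpoint of the chord PS, when i increases by 1, moves
    along T - P, in a direction given by the sign of delta i
    ([chord_sum_step]). Suppose that delta were positive on n consecutive
    sides, starting at k, and let w be the direction of the line l(k). By
    convexity l(k) separates the vertices between k and k + n from the others
    ([fan_turns_left]), so no T - P that occurs points to the right of w, and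
    the first one points strictly to the left. So the midpoint would move
    strictly to the left of w altogether, but after n steps the chord is the
    initial one with its ends exchanged, and the midpoint is back where it was.
    Hence delta is positive on no n consecutive sides
    ([no_positive_half_turn]).

    The rest is combinatorics. Since delta (i + n) = - delta i, the sign of
    delta changes an odd number of times along a half turn. If it changed only
    once, then it would be constant on the n sides after the change and
    opposite on the next n sides, so that delta would be positive on n
    consecutive sides. *)

Set Implicit Arguments.
Unset Strict Implicit.
Unset Printing Implicit Defensive.
Local Open Scope classical_set_scope.

(** * Areas and affine maps *)

Lemma pushforward_is_measure d1 d2 (T1 : measurableType d1)
    (T2 : measurableType d2) (R : realType)
    (m : {measure set T1 -> \bar R}) (f : T1 -> T2) :
  measurable_fun setT f ->
  exists m' : {measure set T2 -> \bar R}, forall A, m' A = m (f @^-1` A).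
Proof. by move=> mf; unshelve eexists (pushforward m f). Qed.

Section LebesgueLine.
Variable R : realType.
Local Notation mu := (@lebesgue_measure R).

Lemma lebesgue_measure_shift (c : R) (A : set R) : measurable A ->
  mu (+%R^~ c @^-1` A) = mu A.
Proof.
move=> mA; apply/esym.
pose f : measurableTypeR R -> measurableTypeR R := +%R^~ c.
have mf : measurable_fun setT f by exact: measurable_funD.
have [m' m'E] := pushforward_is_measure mu mf.
rewrite -[RHS]/(mu (f @^-1` A)) -m'E.
apply: lebesgue_measure_unique => //= _ [[a b]] _ <-.
have -> : m' `]a, b]%classic = mu `]a - c, b - c]%classic.
  rewrite m'E; congr (mu _).
  apply/seteqP; split => y /=; rewrite !in_itv /= /f.
    by rewrite ltrBlDr lerBrDr.
  by rewrite ltrBlDr lerBrDr.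
rewrite !lebesgue_measure_itv /= !lte_fin ltrD2r.
by case: ifP => // _; rewrite -!EFinB; congr EFin; ring.
Qed.

Lemma lebesgue_measure_scale (c : R) (A : set R) : c != 0 -> measurable A ->
  (`|c|%:E * mu ( *%R c @^-1` A) = mu A)%E.
Proof.
move=> c0 mA; apply/esym.
pose f : measurableTypeR R -> measurableTypeR R := *%R c.
have mf : measurable_fun setT f by exact: measurable_funM.
have c0' : (0 <= `|c|)%R by [].
have [m' m'E] := pushforward_is_measure mu mf.
rewrite -[X in (_ * X)%E]/(mu (f @^-1` A)) -m'E.
rewrite -[RHS]/(mscale (NngNum c0') m' A).
apply: lebesgue_measure_unique => //= _ [[a b]] _ <-; rewrite /mscale/=.
have [c_gt0|c_lt0|//] := ltrgtP c 0; last by move=> e; move: c0; rewrite e eqxx.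
have -> : m' `]a, b]%classic = mu `[b / c, a / c[%classic.
  rewrite m'E; congr (mu _).
  apply/seteqP; split => y /=; rewrite !in_itv /= /f andbC.
    by rewrite ler_ndivrMr // ltr_ndivlMr // ![_ * c]mulrC.
  by rewrite ler_ndivrMr // ltr_ndivlMr // ![_ * c]mulrC.
rewrite !lebesgue_measure_itv /= !lte_fin ltr_nM2r ?invr_lt0//.
case: ifP => _; last by rewrite mule0.
by rewrite -!EFinB -EFinM ltr0_norm //; congr EFin; field.
have -> : m' `]a, b]%classic = mu `]a / c, b / c]%classic.
  rewrite m'E; congr (mu _).
  apply/seteqP; split => y /=; rewrite !in_itv /= /f.
    by rewrite ler_pdivlMr // ltr_pdivrMr // ![_ * c]mulrC.
  by rewrite ler_pdivlMr // ltr_pdivrMr // ![_ * c]mulrC.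
rewrite !lebesgue_measure_itv /= !lte_fin ltr_pM2r ?invr_gt0//.
case: ifP => _; last by rewrite mule0.
by rewrite -!EFinB -EFinM gtr0_norm //; congr EFin; field.
Qed.

End LebesgueLine.

Section AffineMaps.
Variable R : realType.
Local Notation mu := (@lebesgue_measure R).

(** Stated with preimages, so that such maps compose without computing
    inverses. *)
Definition scales_area (f : R * R -> R * R) (k : R) :=
  measurable_fun setT f /\
  forall A, measurable A -> (`|k|%:E * area (f @^-1` A) = area A)%E.

Lemma scales_area_comp f g k l :
  scales_area f k -> scales_area g l -> scales_area (f \o g) (k * l).
Proof.
move=> [mf fk] [mg gl]; split; first exact: measurableT_comp.
move=> A mA; rewrite comp_preimage normrM EFinM -muleA gl; first exact: fk.
by rewrite -[X in measurable X]setTI; exact: mf.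
Qed.

Lemma scales_area_swap : scales_area (fun p => (p.2, p.1)) 1.
Proof.
have ms : measurable_fun setT
    (fun p : measurableTypeR R * measurableTypeR R => (p.2, p.1)).
  exact: measurable_swap.
split=> // A mA; rewrite normr1 mul1e; apply/esym.
have [m' m'E] := pushforward_is_measure (mu \x mu)%E ms.
rewrite -[RHS]m'E; apply: product_measure_unique => //= B C mB mC; rewrite m'E.
have -> : (fun p : R * R => (p.2, p.1)) @^-1` (B `*` C) = C `*` B.
  by apply/seteqP; split=> -[x y] [].
by rewrite muleC; exact: product_measure1E.
Qed.

(** The three maps below preserve every vertical line, so their effect on
    areas is seen on the vertical sections. *)
Lemma scales_area_scale c : c != 0 -> scales_area (fun p => (p.1, c * p.2)) c.
Proof.
move=> c0.
have ms : measurable_fun setT (fun p : R * R => (p.1, c * p.2)).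
  apply/measurable_fun_pair; first exact: measurable_fst.
  by apply: measurable_funM => //; exact: measurable_snd.
split=> // A mA; rewrite /area /product_measure1 -ge0_integralZl //=.
  apply: eq_integral => x _.
  rewrite -(@lebesgue_measure_scale _ c (xsection A x)) //.
  exact: measurable_xsection.
apply: measurable_fun_xsection.
by rewrite -[X in measurable X]setTI; exact: ms.
Qed.

Lemma scales_area_shear c : scales_area (fun p => (p.1, p.2 + c * p.1)) 1.
Proof.
have ms : measurable_fun setT (fun p : R * R => (p.1, p.2 + c * p.1)).
  apply/measurable_fun_pair; first exact: measurable_fst.
  apply: measurable_funD; first exact: measurable_snd.
  by apply: measurable_funM => //; exact: measurable_fst.
split=> // A mA; rewrite normr1 mul1e /area /product_measure1.
apply: eq_integral => x _ /=.
rewrite -(@lebesgue_measure_shift _ (c * x) (xsection A x)) //.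
exact: measurable_xsection.
Qed.

Lemma scales_area_shift a : scales_area (fun p => (p.1, p.2 + a)) 1.
Proof.
have ms : measurable_fun setT (fun p : R * R => (p.1, p.2 + a)).
  apply/measurable_fun_pair; first exact: measurable_fst.
  by apply: measurable_funD => //; exact: measurable_snd.
split=> // A mA; rewrite normr1 mul1e /area /product_measure1.
apply: eq_integral => x _ /=.
rewrite -(@lebesgue_measure_shift _ a (xsection A x)) //.
exact: measurable_xsection.
Qed.

Lemma scales_area_translation (a : R * R) : scales_area (fun p => p + a) 1.
Proof.
have := scales_area_comp scales_area_swap
  (scales_area_comp (scales_area_shift a.1)
   (scales_area_comp scales_area_swap (scales_area_shift a.2))).
by rewrite !mulr1; congr scales_area.
Qed.

(** A matrix with nonzero upper left entry factors into shears, scalings and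
    swaps (its LU decomposition); a swap of the columns reduces the other
    matrices to this case. *)
Lemma scales_area_linear a b c d : a * d - b * c != 0 ->
  scales_area (fun p => (a * p.1 + b * p.2, c * p.1 + d * p.2)) (a * d - b * c).
Proof.
wlog a0 : a b c d / a != 0.
  move=> H D0; have [a0|] := eqVneq a 0; last by move=> a0; exact: H.
  have b0 : b != 0 by move: D0; apply: contraNneq => ->; rewrite a0 !mul0r subr0.
  have D0' : b * c - a * d != 0 by rewrite -opprB oppr_eq0.
  have := scales_area_comp (H b a d c b0 D0') scales_area_swap.
  rewrite mulr1 /scales_area -normrN opprB.
  have -> // : (fun p => (b * p.1 + a * p.2, d * p.1 + c * p.2)) \o
    (fun p : R * R => (p.2, p.1)) = (fun p => (a * p.1 + b * p.2, c * p.1 + d * p.2)).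
  by apply/funext => -[x y] /=; congr pair; ring.
move=> D0.
have E0 : (a * d - b * c) / a != 0 by rewrite mulf_neq0 // invr_neq0.
have := scales_area_comp (scales_area_shear (c / a))
  (scales_area_comp (scales_area_scale E0)
  (scales_area_comp scales_area_swap
  (scales_area_comp (scales_area_scale a0)
  (scales_area_comp (scales_area_shear (b / a)) scales_area_swap)))).
rewrite !mul1r !mulr1 divfK //.
set f := (X in scales_area X _ -> _).
have -> // : f = (fun p => (a * p.1 + b * p.2, c * p.1 + d * p.2)).
by apply/funext => -[x y]; rewrite /f /=; congr pair; field.
Qed.

Definition frame (X u v p : R * R) : R * R :=
  (u.1 * p.1 + v.1 * p.2, u.2 * p.1 + v.2 * p.2) + X.

Lemma scales_area_frame X u v :
  det2 u v != 0 -> scales_area (frame X u v) (det2 u v).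
Proof.
rewrite /det2 [u.2 * _]mulrC => uv0.
by have := scales_area_comp (scales_area_translation X)
  (scales_area_linear uv0); rewrite mul1r.
Qed.

End AffineMaps.

(** * Half-planes, triangles and sectors *)

Section Sectors.
Variable R : realType.
Implicit Types (X S T u v w p q : R * R) (a b c s t M : R) (A B K : set (R * R)).
Local Notation mu := (@lebesgue_measure R).

Definition left_side u q : set (R * R) := [set p | 0 <= det2 u (p - q)].
Definition right_side u q : set (R * R) := [set p | det2 u (p - q) <= 0].

Lemma left_sideN u q : left_side (- u) q = right_side u q.
Proof.
apply/seteqP; split=> p;
by rewrite /left_side /right_side /det2 /= !mulNr -opprD oppr_ge0.
Qed.

Lemma right_sideN u q : right_side (- u) q = left_side u q.
Proof. by rewrite -left_sideN opprK. Qed.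

Lemma left_side_shift u q X :
  det2 u (X - q) = 0 -> left_side u q = left_side u X.
Proof.
move=> Xq; have e p : det2 u (p - q) = det2 u (p - X).
  by rewrite -[RHS]addr0 -[Y in _ = _ + Y]Xq /det2 /=; ring.
by apply/seteqP; split=> p; rewrite /left_side /= e.
Qed.

Lemma right_side_shift u q X :
  det2 u (X - q) = 0 -> right_side u q = right_side u X.
Proof.
move=> Xq; rewrite -!left_sideN; apply: left_side_shift.
by rewrite /det2 /= !mulNr -opprD -/(det2 u (X - q)) Xq oppr0.
Qed.

Lemma measurable_left_side u q : measurable (left_side u q).
Proof.
have mf : measurable_fun setT (fun p : R * R => det2 u (p - q)).
  have m1 : measurable_fun setT (fun p : R * R => p.1 - q.1).
    by apply: measurable_funB => //; exact: measurable_fst.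
  have m2 : measurable_fun setT (fun p : R * R => p.2 - q.2).
    by apply: measurable_funB => //; exact: measurable_snd.
  by apply: measurable_funB; apply: measurable_funM.
have -> : left_side u q =
    setT `&` (fun p : R * R => det2 u (p - q)) @^-1` `[0, +oo[.
  by apply/seteqP; split => p; rewrite /left_side /= in_itv /= andbT // => -[].
exact: mf.
Qed.

Lemma measurable_right_side u q : measurable (right_side u q).
Proof. by rewrite -left_sideN; exact: measurable_left_side. Qed.

Lemma measurable_line u q : measurable [set p | det2 u (p - q) = 0].
Proof.
rewrite [X in measurable X](_ : _ = left_side u q `&` right_side u q).
  by apply: measurableI;
    [exact: measurable_left_side|exact: measurable_right_side].
apply/seteqP; split=> p; rewrite /left_side /right_side /=; first by move=> ->.
by case=> H1 H2; apply/eqP; rewrite eq_le H1 H2.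
Qed.

Lemma area_line u q : u != 0 -> area [set p | det2 u (p - q) = 0] = 0%E.
Proof.
(* In the frame formed by u and its rotation by a right angle, the line is the
   first coordinate axis. *)
move=> u0; pose w : R * R := (- u.2, u.1).
have uw : det2 u w != 0.
  apply: contra u0; rewrite /det2 /w /= mulrN opprK -!expr2.
  rewrite paddr_eq0 ?sqr_ge0 // !sqrf_eq0 => /andP[/eqP u1 /eqP u2].
  by rewrite (surjective_pairing u) u1 u2.
have [_ <-] := scales_area_frame q uw; last exact: measurable_line.
have -> : frame q u w @^-1` [set p | det2 u (p - q) = 0] = setT `*` [set 0].
  apply/seteqP; split=> p; rewrite /frame /= addrK.
    have -> : det2 u (u.1 * p.1 + w.1 * p.2, u.2 * p.1 + w.2 * p.2) = det2 u w * p.2.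
      by rewrite /det2 /=; ring.
    by move/eqP; rewrite mulf_eq0 (negPf uw) /= => /eqP.
  by case=> _ ->; rewrite /det2 /=; ring.
have -> : area (setT `*` [set 0]) = (mu setT * mu [set 0%R])%E.
  exact: product_measure1E.
by rewrite lebesgue_measure_set1 !mule0.
Qed.

Lemma le_area A B :
  measurable A -> measurable B -> A `<=` B -> (area A <= area B)%E.
Proof. by move=> mA mB AB; apply: le_measure; rewrite ?inE. Qed.

Lemma area_sub0 A B : measurable A -> measurable B -> A `<=` B ->
  area B = 0%E -> area A = 0%E.
Proof. by move=> mA mB AB B0; apply/eqP; rewrite eq_le -{1}B0 le_area //=. Qed.

Lemma area_bounded A M : measurable A ->
  (forall p, A p -> `|p.1| <= M /\ `|p.2| <= M) -> (area A < +oo)%E.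
Proof.
move=> mA AM.
pose I : set R := `[- M, M]%classic.
have mI : measurable I by exact: measurable_itv.
apply: (@le_lt_trans _ _ (area (I `*` I))).
  apply: le_area => //; first exact: measurableX.
  by move=> p /AM[]; rewrite /I /= !in_itv /= !ler_norml.
have -> : area (I `*` I) = (mu I * mu I)%E by exact: product_measure1E.
rewrite /I lebesgue_measure_itv /=.
by case: ifP => _; rewrite ?mul0e // -!EFinB -EFinM ltry.
Qed.

Definition std_triangle : set (R * R) :=
  [set p | [/\ 0 <= p.1, 0 <= p.2 & p.1 + p.2 <= 1]].

Lemma measurable_std_triangle : measurable std_triangle.
Proof.
have -> : std_triangle =
    left_side (0, -1) 0 `&` left_side (1, 0) 0 `&` left_side (-1, 1) (1, 0).
  apply/seteqP; split=> -[x y]; rewrite /left_side /det2 /= => -[].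
    by move=> /= x0 y0 xy; split; [split|]; lra.
  by case=> x0 y0 xy; split; rewrite /=; lra.
do 2?apply: measurableI; exact: measurable_left_side.
Qed.

(** The areas of two triangles are only compared with each other, so it is
    enough that this common unit is positive and finite. *)
Lemma area_std_triangle : exists2 c, 0 < c & area std_triangle = c%:E.
Proof.
have fin : (area std_triangle < +oo)%E.
  apply: (@area_bounded _ 1 measurable_std_triangle) => -[x y] [/= x0 y0 xy].
  by rewrite !ger0_norm //; split; lra.
pose I : set R := `[0, 2^-1]%classic.
have mI : measurable I by exact: measurable_itv.
have pos : (0 < area std_triangle)%E.
  apply: (@lt_le_trans _ _ (area (I `*` I))).
    have -> : area (I `*` I) = (mu I * mu I)%E by exact: product_measure1E.
    rewrite /I lebesgue_measure_itv /= lte_fin invr_gt0 ltr0n /= -EFinB subr0.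
    by rewrite -EFinM lte_fin mulr_gt0 // invr_gt0.
  apply: le_area; [exact: measurableX|exact: measurable_std_triangle|].
  move=> -[x y] []; rewrite /I /= !in_itv /= => /andP[x0 x1] /andP[y0 y1].
  by split=> //=; lra.
exists (fine (area std_triangle)); last by rewrite fineK // ge0_fin_numE // ltW.
by rewrite fine_gt0 // pos fin.
Qed.

(** The sector of K at X between the directions u and v is the triangle with
    vertices X, X + a u and X + b v. When a or b vanishes K may contain more of
    the sector than this degenerate triangle, but only points of a line. *)
Lemma area_wedge K X u v a b : measurable K ->
  (forall p, std_triangle p ->
     K (frame X (a * u.1, a * u.2) (b * v.1, b * v.2) p)) ->
  0 < det2 u v -> 0 <= a -> 0 <= b -> 0 < a + b ->
  (forall p, K p -> 0 <= det2 (b * v.1 - a * u.1, b * v.2 - a * u.2)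
                             (p - (X + (a * u.1, a * u.2)))) ->
  area (K `&` left_side u X `&` right_side v X) =
  ((a * b * det2 u v)%:E * area std_triangle)%E.
Proof.
move=> mK triK D0 a0 b0 ab0 Kside.
set E := _ `&` _.
have mE : measurable E.
  apply: measurableI; last exact: measurable_right_side.
  by apply: measurableI => //; exact: measurable_left_side.
have [ab|ab] := eqVneq (a * b) 0.
  rewrite ab mul0r mul0e.
  move/eqP: ab; rewrite mulf_eq0 => /orP[/eqP a_0|/eqP b_0].
    have v0 : v != 0.
      by apply: contraTneq D0 => ->; rewrite /det2 /= !mulr0 subr0 ltxx.
    apply: (area_sub0 mE _ _ (area_line X v0)); first exact: measurable_line.
    move=> p [[Kp _] vp]; apply/eqP; rewrite eq_le [_ <= 0]vp /=.
    have b_gt0 : 0 < b by rewrite a_0 add0r in ab0.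
    have := Kside _ Kp; rewrite a_0 /det2 /= => H.
    rewrite -(pmulr_rge0 _ b_gt0).
    by apply: le_trans H _; lra.
  have u0 : u != 0.
    by apply: contraTneq D0 => ->; rewrite /det2 /= !mul0r subr0 ltxx.
  apply: (area_sub0 mE _ _ (area_line X u0)); first exact: measurable_line.
  move=> p [[Kp up] _]; apply/eqP; rewrite eq_le [0 <= _]up andbT.
  have a_gt0 : 0 < a by rewrite b_0 addr0 in ab0.
  have := Kside _ Kp; rewrite b_0 /det2 /= => H.
  rewrite -oppr_ge0 -(pmulr_rge0 _ a_gt0).
  by apply: le_trans H _; lra.
have a_gt0 : 0 < a.
  by rewrite lt_neqAle a0 andbT eq_sym; apply: contraNneq ab => ->; rewrite mul0r.
have b_gt0 : 0 < b.
  by rewrite lt_neqAle b0 andbT eq_sym; apply: contraNneq ab => ->; rewrite mulr0.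
pose f := frame X (a * u.1, a * u.2) (b * v.1, b * v.2).
have detE : det2 (a * u.1, a * u.2) (b * v.1, b * v.2) = a * b * det2 u v.
  by rewrite /det2 /=; ring.
have D0' : det2 (a * u.1, a * u.2) (b * v.1, b * v.2) != 0.
  by rewrite detE mulf_neq0 // gt_eqF.
have [_ <- //] := scales_area_frame X D0'.
rewrite detE ger0_norm ?mulr_ge0 // ?ltW //.
congr (_ * area _)%E.
(* In the frame of f the three inequalities that define the sector are those
   that define the standard triangle. *)
have eu p : det2 u (f p - X) = (b * det2 u v) * p.2.
  by rewrite /f /frame addrK /det2 /=; ring.
have ev p : det2 v (f p - X) = - (a * det2 u v * p.1).
  by rewrite /f /frame addrK /det2 /=; ring.
have es p : det2 (b * v.1 - a * u.1, b * v.2 - a * u.2)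
    (f p - (X + (a * u.1, a * u.2))) = (a * b * det2 u v) * (1 - (p.1 + p.2)).
  by rewrite /f /frame /det2 /=; ring.
apply/seteqP; split=> p.
  case=> -[Kp]; rewrite /left_side /right_side /= -/f eu ev oppr_le0 => p2 p1.
  have := Kside _ Kp; rewrite es.
  rewrite !pmulr_rge0 ?mulr_gt0 // in p1 p2 *.
  by rewrite subr_ge0; split.
move=> Tp; have [p1 p2 _] := Tp; split; first split; first exact: triK.
  by rewrite /left_side /= -/f eu !mulr_ge0 // ltW.
by rewrite /right_side /= -/f ev oppr_le0 !mulr_ge0 // ltW.
Qed.

(** Three points at a time, so that a triangle is covered without dividing by
    its weights. *)
Definition plane_convex K := forall p q r a b c, K p -> K q -> K r ->
  0 <= a -> 0 <= b -> 0 <= c -> a + b + c = 1 ->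
  K (a * p.1 + b * q.1 + c * r.1, a * p.2 + b * q.2 + c * r.2).

(** When K is convex and lies to the left of ST, its sector XST is the triangle
    XST. *)
Lemma area_sector K X S T u v a b : measurable K -> plane_convex K ->
  K X -> K S -> K T -> 0 <= a -> 0 <= b -> 0 < a + b -> 0 < det2 u v ->
  X.1 + a * u.1 = S.1 -> X.2 + a * u.2 = S.2 ->
  X.1 + b * v.1 = T.1 -> X.2 + b * v.2 = T.2 ->
  (forall p, K p -> 0 <= det2 (T - S) (p - S)) ->
  area (K `&` left_side u X `&` right_side v X) =
  ((a * b * det2 u v)%:E * area std_triangle)%E.
Proof.
move=> mK Kc KX KS KT a0 b0 ab0 uv0 S1 S2 T1 T2 sST.
apply: area_wedge => //.
  move=> -[s t] [/= s0 t0 st].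
  have e : 1 - s - t + s + t = 1 by ring.
  have st0 : 0 <= 1 - s - t by lra.
  have := Kc X S T (1 - s - t) s t KX KS KT st0 s0 t0 e; congr K.
  by rewrite -S1 -S2 -T1 -T2 [RHS]surjective_pairing /frame /=; congr pair; ring.
move=> p Kp; suff <- : det2 (T - S) (p - S) =
    det2 (b * v.1 - a * u.1, b * v.2 - a * u.2) (p - (X + (a * u.1, a * u.2))).
  exact: sST.
by rewrite /det2 /= -S1 -S2 -T1 -T2; ring.
Qed.

(** The two parts overlap in a line, which has no area. *)
Lemma area_split A u q : measurable A -> u != 0 ->
  (area A = area (A `&` left_side u q) + area (A `&` right_side u q))%E.
Proof.
move=> mA u0; set L := left_side u q; set L' := right_side u q.
have mL : measurable L by exact: measurable_left_side.
have mL' : measurable L' by exact: measurable_right_side.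
have areaDI B : measurable B -> (area B = area (B `&` L) + area (B `\` L))%E.
  by move=> mB; rewrite addeC; exact: measureDI.
rewrite (areaDI _ mA); congr (_ + _)%E.
rewrite (areaDI (A `&` L')); last exact: measurableI.
rewrite (_ : area (A `&` L' `&` L) = 0%E).
  rewrite add0e; congr area.
  apply/seteqP; split=> p; last by case=> -[Ap _] ?.
  case=> Ap Lp; split; last exact: Lp.
  split=> //; move: Lp; rewrite /L /L' /left_side /right_side /= => /negP.
  by rewrite -ltNge => /ltW.
apply: (@area_sub0 _ [set p | det2 u (p - q) = 0] _ _ _ (area_line q u0)).
- by do 2?apply: measurableI.
- exact: measurable_line.
- by move=> p [[_ h1] h2]; apply/eqP; rewrite eq_le; apply/andP; split.
Qed.

Lemma cross_sum_eq (a b c d : \bar R) :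
  a \is a fin_num -> b \is a fin_num -> c \is a fin_num -> d \is a fin_num ->
  (a + b = c + d)%E -> (a + c = b + d)%E -> b = c.
Proof.
move: a b c d => [a||] [b||] [c||] [d||] //= _ _ _ _.
by rewrite -!EFinD => -[h1] [h2]; congr EFin; lra.
Qed.

(** Two halving lines cut K into four sectors, and any two adjacent sectors
    form one half of K: subtracting the two resulting equations leaves one pair
    of opposite sectors. *)
Lemma area_opposite_sectors K M u q v r :
  measurable K -> (forall p, K p -> `|p.1| <= M /\ `|p.2| <= M) ->
  u != 0 -> v != 0 ->
  area (K `&` left_side u q) = area (K `&` right_side u q) ->
  area (K `&` left_side v r) = area (K `&` right_side v r) ->
  area (K `&` left_side u q `&` right_side v r) =
  area (K `&` right_side u q `&` left_side v r).
Proof.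
move=> mK KM u0 v0.
have mL := measurable_left_side; have mL' := measurable_right_side.
have fin A B : measurable A -> measurable B -> area (K `&` A `&` B) \is a fin_num.
  move=> mA mB; rewrite ge0_fin_numE; last exact: measure_ge0.
  apply: (@area_bounded _ M); first by do 2?apply: measurableI.
  by move=> p [[/KM]].
have mKI A : measurable A -> measurable (K `&` A) by exact: measurableI.
have E1 := area_split r (mKI _ (mL u q)) v0.
have E2 := area_split r (mKI _ (mL' u q)) v0.
have E3 := area_split q (mKI _ (mL v r)) u0.
have E4 := area_split q (mKI _ (mL' v r)) u0.
rewrite (setIAC K (left_side v r) (left_side u q)) in E3.
rewrite (setIAC K (left_side v r) (right_side u q)) in E3.
rewrite (setIAC K (right_side v r) (left_side u q)) in E4.
rewrite (setIAC K (right_side v r) (right_side u q)) in E4.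
move=> hu hv.
move: (etrans (esym E1) (etrans hu E2)) (etrans (esym E3) (etrans hv E4)).
exact: (cross_sum_eq (fin _ _ (mL u q) (mL v r)) (fin _ _ (mL u q) (mL' v r))
  (fin _ _ (mL' u q) (mL v r)) (fin _ _ (mL' u q) (mL' v r))).
Qed.

End Sectors.

(** * The trapezoid cut off by two consecutive halving chords *)

Section Trapezoid.
Variable R : realType.
Implicit Types (K : set (R * R)) (u v w a b p q : R * R).

Lemma det2_eq0_proportional w a b : w != 0 ->
  det2 w a = 0 -> det2 w b = 0 -> det2 a b = 0.
Proof.
move=> w0 wa wb.
have h1 : det2 a b * w.1 = 0.
  have -> : det2 a b * w.1 = det2 w b * a.1 - det2 w a * b.1 by rewrite /det2; ring.
  by rewrite wa wb !mul0r subr0.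
have h2 : det2 a b * w.2 = 0.
  have -> : det2 a b * w.2 = det2 w b * a.2 - det2 w a * b.2 by rewrite /det2; ring.
  by rewrite wa wb !mul0r subr0.
apply/eqP; apply: contraNT w0 => ab0.
move/eqP: h1; move/eqP: h2; rewrite !mulf_eq0 !(negPf ab0) /= => /eqP h2 /eqP h1.
by rewrite (surjective_pairing w) h1 h2.
Qed.

(** Let PS and QT halve K, let PQ and ST be edges of K, and let X be the common
    point of PS and QT. With D = [S - P, T - Q] the point X divides PS in the
    ratio t2 : t4 and QT in the ratio t1 : t3, so the sectors XST and XPQ have
    areas proportional to t3 t4 / D and t1 t2 / D. As
    D = t1 + t3 = t2 + t4, equality of the areas means that D = t1 + t2, which
    is t2 = t3: the points Q and S are equally far from PT, that is, QS is
    parallel to PT. *)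
Lemma halving_trapezoid K M (P Q S T : R * R) :
  measurable K -> (forall p, K p -> `|p.1| <= M /\ `|p.2| <= M) ->
  plane_convex K -> K P -> K Q -> K S -> K T ->
  P != S ->
  (forall p, K p -> 0 <= det2 (Q - P) (p - P)) ->
  (forall p, K p -> 0 <= det2 (T - S) (p - S)) ->
  det2 (Q - P) (T - S) != 0 ->
  area (K `&` left_side (S - P) P) = area (K `&` right_side (S - P) P) ->
  area (K `&` left_side (T - Q) Q) = area (K `&` right_side (T - Q) Q) ->
  det2 (Q - P) (T - P) = det2 (T - S) (P - S).
Proof.
move=> mK KM Kc KP KQ KS KT PS sPQ sST dl hP hQ.
set D := det2 (S - P) (T - Q).
set t1 := det2 (Q - P) (S - P). set t2 := det2 (Q - P) (T - P).
set t3 := det2 (T - S) (P - S). set t4 := det2 (T - S) (Q - S).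
have t1_0 : 0 <= t1 by exact: sPQ.
have t2_0 : 0 <= t2 by exact: sPQ.
have t3_0 : 0 <= t3 by exact: sST.
have t4_0 : 0 <= t4 by exact: sST.
have D13 : D = t1 + t3 by rewrite /D /t1 /t3 /det2 /=; ring.
have D24 : D = t2 + t4 by rewrite /D /t2 /t4 /det2 /=; ring.
have dl21 : det2 (Q - P) (T - S) = t2 - t1 by rewrite /t1 /t2 /det2 /=; ring.
have dl34 : det2 (Q - P) (T - S) = t3 - t4 by rewrite /t3 /t4 /det2 /=; ring.
have D0 : 0 < D.
  rewrite lt_neqAle D13 addr_ge0 // andbT eq_sym paddr_eq0 //.
  apply: contra dl => /andP[/eqP t10 /eqP t30].
  have SP : S - P != 0 by rewrite subr_eq0 eq_sym.
  rewrite dl21 t10 subr0; apply/eqP.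
  apply: (det2_eq0_proportional SP).
    have -> : det2 (S - P) (Q - P) = - t1 by rewrite /t1 /det2 /=; ring.
    by rewrite t10 oppr0.
  have <- // : t3 = det2 (S - P) (T - P) by rewrite /t3 /det2 /=; ring.
have D0' : D != 0 by rewrite gt_eqF.
have t12 : 0 < t2 / D + t1 / D.
  rewrite -mulrDl divr_gt0 // lt_neqAle addr_ge0 // andbT eq_sym paddr_eq0 //.
  by apply: contra dl => /andP[/eqP t10 /eqP t20]; rewrite dl21 t10 t20 subrr.
have t34 : 0 < t4 / D + t3 / D.
  rewrite -mulrDl divr_gt0 // lt_neqAle addr_ge0 // andbT eq_sym paddr_eq0 //.
  by apply: contra dl => /andP[/eqP t40 /eqP t30]; rewrite dl34 t30 t40 subrr.
have SP0 : S - P != 0 by rewrite subr_eq0 eq_sym.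
have TQ0 : T - Q != 0.
  by apply: contraNneq D0' => TQ; rewrite /D TQ /det2 /= !mulr0 subrr.
have := area_opposite_sectors mK KM SP0 TQ0 hP hQ.
have De : D = det2 (S - P) (T - Q) by [].
have t1e : t1 = det2 (Q - P) (S - P) by [].
have t2e : t2 = det2 (Q - P) (T - P) by [].
clearbody D t1 t2 t3 t4.
pose X : R * R := (P.1 + t2 / D * (S - P).1, P.2 + t2 / D * (S - P).2).
have t4E : t4 = D - t2 by rewrite D24; ring.
have t3E : t3 = D - t1 by rewrite D13; ring.
have XS1 : X.1 + t4 / D * (S.1 - P.1) = S.1 by rewrite t4E /X /=; field.
have XS2 : X.2 + t4 / D * (S.2 - P.2) = S.2 by rewrite t4E /X /=; field.
have XQ1 : X.1 = Q.1 + t1 / D * (T.1 - Q.1).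
  transitivity ((P.1 * D + t2 * (S.1 - P.1)) / D); first by rewrite /X /=; field.
  transitivity ((Q.1 * D + t1 * (T.1 - Q.1)) / D); last by field.
  by congr (_ / _); rewrite De t1e t2e /det2 /=; ring.
have XQ2 : X.2 = Q.2 + t1 / D * (T.2 - Q.2).
  transitivity ((P.2 * D + t2 * (S.2 - P.2)) / D); first by rewrite /X /=; field.
  transitivity ((Q.2 * D + t1 * (T.2 - Q.2)) / D); last by field.
  by congr (_ / _); rewrite De t1e t2e /det2 /=; ring.
have XT1 : X.1 + t3 / D * (T.1 - Q.1) = T.1 by rewrite XQ1 t3E; field.
have XT2 : X.2 + t3 / D * (T.2 - Q.2) = T.2 by rewrite XQ2 t3E; field.
have KX : K X.
  have := Kc P S S (t4 / D) (t2 / D) 0 KP KS KS.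
  rewrite !divr_ge0 ?(ltW D0) // => /(_ isT isT (lexx _)).
  have e : t4 / D + t2 / D + 0 = 1 by rewrite t4E; field.
  by move=> /(_ e); congr K; rewrite /X t4E /=; congr pair; field.
have XP1 : X.1 = P.1 + t2 / D * (S - P).1 by [].
have XP2 : X.2 = P.2 + t2 / D * (S - P).2 by [].
clearbody X.
have XonP : det2 (S - P) (X - P) = 0 by rewrite /det2 /= XP1 XP2 /=; ring.
have XonQ : det2 (T - Q) (X - Q) = 0 by rewrite /det2 /= XQ1 XQ2; ring.
have XST : area (K `&` left_side (S - P) P `&` right_side (T - Q) Q) =
    ((t4 / D * (t3 / D) * D)%:E * area (@std_triangle R))%E.
  rewrite (left_side_shift XonP) (right_side_shift XonQ).
  rewrite [X in (_ * X)%:E]De; apply: (@area_sector _ _ _ S T) => //.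
  - by rewrite !divr_ge0 // ltW.
  - by rewrite !divr_ge0 // ltW.
  - by rewrite -De.
have XPQ : area (K `&` right_side (S - P) P `&` left_side (T - Q) Q) =
    ((t2 / D * (t1 / D) * D)%:E * area (@std_triangle R))%E.
  rewrite (right_side_shift XonP) (left_side_shift XonQ).
  rewrite -(left_sideN (S - P) X) -(right_sideN (T - Q) X).
  have De' : D = det2 (- (S - P)) (- (T - Q)) by rewrite De /det2 /=; ring.
  rewrite [X in (_ * X)%:E]De'; apply: (@area_sector _ _ _ P Q) => //.
  - by rewrite !divr_ge0 // ltW.
  - by rewrite !divr_ge0 // ltW.
  - by rewrite -De'.
  - by rewrite XP1 /=; ring.
  - by rewrite XP2 /=; ring.
  - by rewrite XQ1 /=; ring.
  - by rewrite XQ2 /=; ring.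
rewrite XST XPQ; have [c c0 ->] := area_std_triangle R.
rewrite -!EFinM => -[/(mulIf (lt0r_neq0 c0)) /(mulIf D0')].
move=> h; have h' : t4 * t3 = t2 * t1.
  transitivity (t4 / D * (t3 / D) * D * D); first by field.
  by rewrite h; field.
have /eqP : D * (D - (t1 + t2)) = 0.
  have -> : D * (D - (t1 + t2)) = (D - t2) * (D - t1) - t2 * t1 by ring.
  by rewrite -t4E -t3E h' subrr.
by rewrite mulf_eq0 (negPf D0') /= => /eqP; rewrite D13; lra.
Qed.

End Trapezoid.

(** * The region is convex, bounded and measurable *)

Section Region.
Variable R : realType.

(** The product sigma-algebra is generated by rectangles, so the open set has
    to be written as a countable union of rectangles: those with rational
    center and half-side 1 / (k + 1) that it contains. *)
Lemma open_measurable_plane (U : set (R * R)) : open U -> measurable U.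
Proof.
move=> oU.
pose B (q1 q2 : rat) (k : nat) : set (R * R) :=
  ball (ratr q1 : R) k.+1%:R^-1 `*` ball (ratr q2 : R) k.+1%:R^-1.
have mB q1 q2 k : measurable (B q1 q2 k).
  by apply: measurableX; apply: open_measurable; exact: ball_open.
have -> : U = \bigcup_(q1 : rat) \bigcup_(q2 : rat) \bigcup_(k : nat)
    (if `[< B q1 q2 k `<=` U >] then B q1 q2 k else set0).
  apply/seteqP; split=> [p Up|p [q1 _ [q2 _ [k _]]]]; last first.
    by case: asboolP => // BU /BU.
  have /nbhs_ballP[e /= e0 eU] : nbhs p U by exact: open_nbhs_nbhs.
  pose k := Num.truncn (2 / e).
  have ke : k.+1%:R^-1 < e / 2.
    have h : 2 / e < k.+1%:R by exact: truncnS_gt.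
    by rewrite -[ltRHS]invf_div ltf_pV2 // posrE ?divr_gt0.
  have k0 : 0 < k.+1%:R^-1 :> R by rewrite invr_gt0.
  have rat_ball (x : R) : exists q : rat, ball x k.+1%:R^-1 (ratr q : R).
    have ne : ball x k.+1%:R^-1 !=set0 by exists x; exact: ballxx.
    have [y [h [q _ qy]]] := dense_rat ne (ball_open _ _).
    by exists q; rewrite qy.
  have [q1 Hq1] := rat_ball p.1; have [q2 Hq2] := rat_ball p.2.
  exists q1 => //; exists q2 => //; exists k => //.
  case: asboolP => [_|[]]; first by split; apply: ball_sym.
  move=> r [/= r1 r2]; apply: eU.
  have h a b q : ball a k.+1%:R^-1 (ratr q : R) ->
      ball (ratr q : R) k.+1%:R^-1 b -> ball a e b.
    move=> aq qb; apply: (@le_ball _ _ _ (k.+1%:R^-1 + k.+1%:R^-1)).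
      by rewrite [e]splitr lerD // ltW.
    exact: ball_triangle qb.
  by split; [exact: h r1|exact: h r2].
apply: bigcupT_measurable_rat => q1; apply: bigcupT_measurable_rat => q2.
by apply: bigcupT_measurable => k; case: asboolP.
Qed.

Lemma compact_measurable_plane (K : set (R * R)) : compact K -> measurable K.
Proof.
move=> /compact_closed cK; rewrite -[K]setCK; apply: measurableC.
apply: open_measurable_plane; rewrite openC; apply: cK.
exact: norm_hausdorff.
Qed.

Variable n : nat.
Variable gamma : 'Z_(2 * n) -> R * R.

(** The region is the image of a simplex of weights, which is compact, by a
    continuous map. *)
Lemma region_compact : compact (region gamma).
Proof.
pose T := 'rV[R]_(Zp_trunc (2 * n)).+2.
pose f (v : T) : R * R :=
  (\sum_i v ord0 i * (gamma i).1, \sum_i v ord0 i * (gamma i).2).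
pose S : set T := [set v | forall i, `[0, 1]%classic (v ord0 i)] `&`
  [set v | \sum_i v ord0 i = 1].
have -> : region gamma = f @` S.
  apply/seteqP; split=> p.
    case=> t [t0 t1 ->]; exists (\row_i t i).
      split=> /= [i|].
        rewrite mxE in_itv /= t0 /= -t1 (bigD1 i) //= lerDl.
        by apply: sumr_ge0.
      by rewrite -[RHS]t1; apply: eq_bigr => i _; rewrite mxE.
    by rewrite /f; congr pair; apply: eq_bigr => i _; rewrite mxE.
  case=> v [v01 v1] <-; exists (fun i => v ord0 i); split=> // i.
  by have := v01 i; rewrite /= in_itv /= => /andP[].
have cf (c : 'I_(Zp_trunc (2 * n)).+2 -> R) :
    continuous (fun v : T => \sum_i v ord0 i * c i).
  apply: continuous_big => [|i _ v]; first exact: add_continuous.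
  by apply: continuousM; [exact: coord_continuous|exact: cst_continuous].
apply: continuous_compact.
  apply: continuous_subspaceT => v.
  exact: (cvg_pair (cf (fun i => (gamma i).1) v) (cf (fun i => (gamma i).2) v)).
apply: compact_closedI.
  exact: (@rV_compact R _ (fun=> `[0, 1]%classic) (fun=> @segment_compact R 0 1)).
have c1 : continuous (fun v : T => \sum_i v ord0 i).
  have := cf (fun=> 1).
  have -> // : (fun v : T => \sum_i v ord0 i * 1) = (fun v : T => \sum_i v ord0 i).
  by apply/funext => v; apply: eq_bigr => i _; rewrite mulr1.
apply: (@closed_comp _ _ (fun v : T => \sum_i v ord0 i) [set 1]) => [v _|].
  exact: c1.
exact: closed_eq.
Qed.

Lemma region_measurable : measurable (region gamma).
Proof. by apply: compact_measurable_plane; exact: region_compact. Qed.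

Lemma region_bounded :
  exists M : R, forall p, region gamma p -> `|p.1| <= M /\ `|p.2| <= M.
Proof.
exists (\sum_i (`|(gamma i).1| + `|(gamma i).2|)) => _ [t [t0 t1 ->]] /=.
have t01 i : t i <= 1 by rewrite -t1 (bigD1 i) //= lerDl; apply: sumr_ge0.
split; apply: le_trans (ler_norm_sum _ _ _) _; apply: ler_sum => i _.
  rewrite normrM ger0_norm //; apply: le_trans (_ : `|(gamma i).1| <= _).
    by apply: ler_piMl.
  by rewrite lerDl.
rewrite normrM ger0_norm //; apply: le_trans (_ : `|(gamma i).2| <= _).
  by apply: ler_piMl.
by rewrite lerDr.
Qed.

Lemma region_vertex i : region gamma (gamma i).
Proof.
exists (fun j => (j == i)%:R); split=> [j||]; first exact: ler0n.
  by rewrite (bigD1 i) //= eqxx big1 ?addr0 // => j /negPf ->.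
rewrite [LHS]surjective_pairing; congr pair;
by rewrite (bigD1 i) //= eqxx mul1r big1 ?addr0 // => j /negPf ->; rewrite mul0r.
Qed.

Lemma region_convex : plane_convex (region gamma).
Proof.
move=> p q r a b c [s [s0 s1 ->]] [t [t0 t1 ->]] [w [w0 w1 ->]] a0 b0 c0 abc.
exists (fun i => a * s i + b * t i + c * w i); split=> [i||].
- by rewrite !addr_ge0 // mulr_ge0.
- by rewrite !big_split -!mulr_sumr s1 t1 w1 !mulr1.
- congr pair; rewrite /= !mulr_sumr -!big_split;
  by apply: eq_bigr => i _ /=; ring.
Qed.

Lemma region_halfplane u c p :
  (forall i, c <= det2 u (gamma i)) -> region gamma p -> c <= det2 u p.
Proof.
move=> H [t [t0 t1 ->]].
have -> : det2 u (\sum_i t i * (gamma i).1, \sum_i t i * (gamma i).2) =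
   \sum_i t i * det2 u (gamma i).
  by rewrite /det2 /= !mulr_sumr -sumrB; apply: eq_bigr => i _; ring.
rewrite -[c]mul1r -t1 mulr_suml; apply: ler_sum => i _.
by rewrite ler_wpM2l.
Qed.

End Region.

(** * Turning left within a half-plane *)

Section Plane.
Variable R : realType.
Implicit Types u v w a b c e : R * R.

Definition dot u v : R := u.1 * v.1 + u.2 * v.2.

Lemma dot_gt0 u : u != 0 -> 0 < dot u u.
Proof.
move=> u0; rewrite lt_neqAle addr_ge0 -?expr2 ?sqr_ge0 // andbT eq_sym.
rewrite paddr_eq0 ?sqr_ge0 // !sqrf_eq0.
apply: contra u0 => /andP[/eqP u1 /eqP u2].
by rewrite (surjective_pairing u) u1 u2.
Qed.

Lemma dot_det2_eq0 u w : u != 0 -> det2 u w = 0 -> dot u w = 0 -> w = 0.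
Proof.
move=> u0 uw0 duw0; have uu := dot_gt0 u0.
rewrite (surjective_pairing w); congr pair; apply: (mulfI (lt0r_neq0 uu)).
  transitivity (u.1 * dot u w - u.2 * det2 u w); first by rewrite /dot /det2; ring.
  by rewrite uw0 duw0 !mulr0 subrr.
transitivity (u.2 * dot u w + u.1 * det2 u w); first by rewrite /dot /det2; ring.
by rewrite uw0 duw0 !mulr0 addr0.
Qed.

(** [dot e a] and [det2 e a] are, up to a common factor, the coordinates of a
    in the orthogonal basis formed by e and its rotation by a right angle. *)
Lemma det2_basis e a b :
  dot e e * det2 a b = dot e a * det2 e b - det2 e a * dot e b.
Proof. by rewrite /dot /det2; ring. Qed.

Definition opposite_ray e a := det2 e a = 0 /\ dot e a < 0.

(** For nonzero vectors in the closed half-plane to the left of e this compares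
    their angles with e, which range from 0 to pi. The sign of [det2 a b] alone does
    not, since it vanishes when the angle of a is pi and that of b is 0. *)
Definition turns_left e a b :=
  0 <= det2 a b /\ (opposite_ray e a -> opposite_ray e b).

Lemma turns_left_trans e a b c : e != 0 -> a != 0 -> b != 0 ->
  0 <= det2 e a -> 0 <= det2 e b -> 0 <= det2 e c ->
  turns_left e a b -> turns_left e b c -> turns_left e a c.
Proof.
move=> e0 a0 b0 ea eb ec [ab nab] [bc nbc]; split; last by move/nab/nbc.
have ee := dot_gt0 e0.
have [eb0|eb0] := eqVneq (det2 e b) 0; last first.
  have eb1 : 0 < det2 e b by rewrite lt_neqAle eq_sym eb0.
  rewrite -(pmulr_rge0 _ eb1).
  have -> : det2 e b * det2 a c = det2 a b * det2 e c + det2 b c * det2 e a.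
    by rewrite /det2; ring.
  by rewrite addr_ge0 // mulr_ge0.
rewrite -(pmulr_rge0 _ ee) det2_basis.
have [db|db|db] := ltgtP (dot e b) 0.
- have [-> dc] := nbc (conj eb0 db).
  by rewrite mulr0 add0r -mulrN mulr_ge0 // oppr_ge0 ltW.
- have ea0 : det2 e a = 0.
    apply/eqP; rewrite eq_le ea andbT -(pmulr_lle0 _ db).
    have := ab; rewrite -(pmulr_rge0 _ ee) det2_basis eb0 mulr0 add0r oppr_ge0.
    by rewrite mulrC.
  rewrite ea0 mul0r subr0 mulr_ge0 // leNgt; apply/negP => da.
  by have [_] := nab (conj ea0 da); rewrite ltNge (ltW db).
- by move/eqP: b0; case; exact: dot_det2_eq0 db.
Qed.

End Plane.

(** * Index arithmetic *)

Local Notation opp := Defs.opp.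

Lemma natr_Z_neq0 n m : (0 < m < 2 * n)%N -> m%:R != 0 :> 'Z_(2 * n).
Proof.
move=> /andP[m0 mn]; apply/eqP => /(congr1 val) /=.
by rewrite val_Zp_nat ?modn_small; lia.
Qed.

Section Index.
Variable n : nat.
Hypothesis n_gt0 : (0 < n)%N.
Implicit Types i : 'Z_(2 * n).

Lemma natr_double0 : n%:R + n%:R = 0 :> 'Z_(2 * n).
Proof.
rewrite -natrD addnn -mul2n; apply/val_inj.
by rewrite /= val_Zp_nat ?modnn //; lia.
Qed.

Lemma opp_vertexK i : opp (opp i) = i.
Proof. by rewrite /opp -addrA natr_double0 addr0. Qed.

Lemma opp_vertexS i : opp (i + 1) = opp i + 1.
Proof. by rewrite /opp addrAC. Qed.

Lemma opp_vertexN i : opp (- i) = - opp i.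
Proof.
rewrite /opp opprD; congr (_ + _); apply/eqP.
by rewrite -subr_eq0 opprK natr_double0.
Qed.

End Index.

(** * Global convexity of a counterclockwise polygon *)

Section ConvexPolygons.
Variables (R : realType) (n : nat).
Variable gamma : 'Z_(2 * n) -> R * R.
Hypothesis n_gt0 : (0 < n)%N.
Hypothesis gamma_inj : injective gamma.
Hypothesis noncollinear :
  exists i j k, det2 (gamma j - gamma i) (gamma k - gamma i) != 0.
Hypothesis gamma_left : forall i j, 0 <= det2 (side gamma i) (gamma j - gamma i).
Implicit Types e i k m : 'Z_(2 * n).
Local Notation side := (side gamma).

Lemma side_neq0 i : side i != 0.
Proof.
rewrite /Defs.side subr_eq0 (inj_eq gamma_inj) -subr_eq0 addrAC subrr add0r.
by rewrite (@natr_Z_neq0 n 1) //; lia.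
Qed.

Lemma not_all_on_side_line i : ~ forall k, det2 (side i) (gamma k - gamma i) = 0.
Proof.
move=> H; have [j [k [l /eqP]]] := noncollinear; case.
have Hs k' : det2 (side i) (gamma k' - gamma j) = 0.
  by rewrite -[RHS](subrr 0) -{1}(H k') -[X in _ = _ - X](H j) /det2 /=; ring.
exact: (det2_eq0_proportional (side_neq0 i)).
Qed.

(** If m lies on the line of e ahead of i, the side i does not turn left
    of this line, because m is not to its right, nor right, because gamma (i + 1)
    is not to the right of e. So it stays on the line; if it went backwards, all
    vertices would be both to the left and to the right of the line. *)
Lemma next_on_edge e i m :
  det2 (side e) (gamma i - gamma e) = 0 -> det2 (side e) (gamma m - gamma e) = 0 ->
  dot (side e) (gamma i) < dot (side e) (gamma m) ->
  det2 (side e) (gamma (i + 1) - gamma e) = 0 /\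
  dot (side e) (gamma i) < dot (side e) (gamma (i + 1)).
Proof.
set u := side e => ui um him; set s := side i.
have uu : 0 < dot u u by apply: dot_gt0; exact: side_neq0.
have us : det2 u s = det2 u (gamma (i + 1) - gamma e).
  by rewrite -[RHS]subr0 -[X in _ = _ - X]ui /s /Defs.side /det2 /=; ring.
have uim : det2 u (gamma m - gamma i) = 0.
  by rewrite -[RHS](subrr 0) -{1}um -[X in _ = _ - X]ui /det2 /=; ring.
have dim : 0 < dot u (gamma m - gamma i).
  by move: him; rewrite -subr_gt0 /dot /=; congr (0 < _); ring.
have us0 : det2 u s = 0.
  apply/eqP; rewrite eq_le us gamma_left -us andbT.
  rewrite -(pmulr_lle0 _ dim) mulrC.
  have := gamma_left i m.
  rewrite -/s -(pmulr_rge0 _ uu) det2_basis uim mulr0 add0r.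
  by rewrite oppr_ge0 mulrC.
split; first by rewrite -us.
have hs : dot u (gamma (i + 1)) - dot u (gamma i) = dot u s.
  by rewrite /s /Defs.side /dot /=; ring.
rewrite -subr_gt0 hs ltNge le_eqVlt; apply/negP => /orP[/eqP ds|ds].
  have /eqP := dot_det2_eq0 (side_neq0 e) us0 ds.
  by apply/negP; exact: side_neq0.
apply: (@not_all_on_side_line e) => k; apply/eqP.
rewrite eq_le gamma_left andbT -/u.
have := gamma_left i k; rewrite -/s -(pmulr_rge0 _ uu) det2_basis us0 mul0r subr0.
have -> : det2 u (gamma k - gamma i) = det2 u (gamma k - gamma e).
  by rewrite -[RHS]subr0 -[X in _ = _ - X]ui /det2 /=; ring.
by rewrite nmulr_rge0.
Qed.

(** This is where distinctness of the vertices excludes a listing that goes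
    around several times: two passes along an edge would have to merge at its
    last vertex. *)
Lemma no_vertex_inside_side e k :
  det2 (side e) (gamma k - gamma e) = 0 ->
  dot (side e) (gamma e) < dot (side e) (gamma k) ->
  dot (side e) (gamma k) < dot (side e) (gamma (e + 1)) -> False.
Proof.
set u := side e => uk hek hke.
pose on i := det2 u (gamma i - gamma e) == 0.
pose h i := dot u (gamma i).
have hinj i j : on i -> on j -> h i = h j -> i = j.
  move=> /eqP ui /eqP uj hij; apply: gamma_inj.
  apply/eqP; rewrite -subr_eq0; apply/eqP.
  apply: (@dot_det2_eq0 _ u); first exact: side_neq0.
    by rewrite -[RHS](subrr 0) -{1}ui -[X in _ = _ - X]uj /det2 /=; ring.
  by rewrite -[RHS](subrr (h i)) {2}hij /h /dot /=; ring.
pose bad (p : 'Z_(2 * n) * 'Z_(2 * n)) :=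
  [&& on p.1, on p.2, on (p.1 + 1), h p.1 < h p.2 & h p.2 < h (p.1 + 1)].
have bad0 : bad (e, k).
  rewrite /bad /on /= uk hek hke eqxx subrr.
  by rewrite -/(Defs.side gamma e) -/u /det2 /= !mulr0 subrr mulrC subrr eqxx.
(* Among the vertices l inside a side j take the most advanced one: then l + 1
   lies inside the side j, or j + 1 lies inside the side l, and both are
   further ahead. *)
case: (@Order.TotalTheory.arg_maxP _ R _ (e, k) bad (fun p => h p.2) bad0).
case=> j l /and5P[/= onj onl onj1 hjl hlj] max.
have [/eqP onl1 hl1] := @next_on_edge e l (j + 1) (eqP onl) (eqP onj1) hlj.
rewrite -/(on (l + 1)) in onl1; rewrite -/(h _) -/(h _) in hl1.
have [hlt|hgt|heq] := ltgtP (h (l + 1)) (h (j + 1)).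
- have := max (j, l + 1).
  rewrite /bad /= onj onl1 onj1 hlt (lt_trans hjl hl1) => /(_ isT).
  by rewrite leNgt hl1.
- have := max (l, j + 1); rewrite /bad /= onj1 onl1 onl hgt hlj => /(_ isT).
  by rewrite leNgt hlj.
- have /addIr lj := hinj _ _ onl1 onj1 heq.
  by move: hjl; rewrite lj ltxx.
Qed.

(** Seen from gamma k, all vertices are to the left of the side k, and every
    step to the next vertex turns left by at most pi. It does not turn from the
    angle pi back to the angle 0, as it would then pass over gamma k. So the
    angles never decrease. *)
Lemma fan_turns_left k (j l : nat) : (0 < j)%N -> (j <= l)%N -> (l < 2 * n)%N ->
  0 <= det2 (gamma (k + j%:R) - gamma k) (gamma (k + l%:R) - gamma k).
Proof.
move=> j0; pose v (r : nat) := gamma (k + r%:R) - gamma k.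
have v0 r : (0 < r < 2 * n)%N -> v r != 0.
  move=> rn; rewrite subr_eq0 (inj_eq gamma_inj) -subr_eq0 addrAC subrr add0r.
  exact: natr_Z_neq0.
have vside r : side (k + r%:R) = v r.+1 - v r.
  by rewrite /Defs.side /v -addrA natr1 opprB addrA subrK.
have step r : 0 <= det2 (v r) (v r.+1).
  have := gamma_left (k + r%:R) k; rewrite vside; congr (0 <= _).
  by rewrite -[gamma k - _]opprB -/(v r) /det2 /=; ring.
have ev r : 0 <= det2 (side k) (v r) by exact: gamma_left.
suff H r : (j <= r)%N -> (r < 2 * n)%N -> turns_left (side k) (v j) (v r).
  by move=> jl ln; have [] := H l jl ln.
elim: r => [|r IH]; first by lia.
rewrite leq_eqVlt => /orP[/eqP <- _|jr rn].
  by split=> //; rewrite /det2 mulrC subrr.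
apply: (@turns_left_trans _ _ _ (v r)) => //.
- exact: side_neq0.
- by apply: v0; lia.
- by apply: v0; lia.
- by apply: IH; lia.
split; first exact: step.
set e := side k; case=> er dr.
have ee : 0 < dot e e by apply: dot_gt0; exact: side_neq0.
have er1 : det2 e (v r.+1) = 0.
  apply/eqP; rewrite eq_le ev andbT.
  have := step r; rewrite -(pmulr_rge0 _ ee) det2_basis er mul0r subr0.
  by rewrite nmulr_rge0.
split=> //; rewrite ltNge le_eqVlt; apply/negP => /orP[/eqP dr1|dr1].
  have /eqP := dot_det2_eq0 (side_neq0 k) er1 (esym dr1).
  by apply/negP; apply: v0; lia.
apply: (@no_vertex_inside_side (k + r%:R) k); rewrite vside.
- rewrite -[gamma k - _]opprB -/(v r); apply: (mulfI (lt0r_neq0 ee)).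
  rewrite mulr0 det2_basis.
  have -> : det2 e (- v r) = - det2 e (v r) by rewrite /det2 /=; ring.
  have -> : det2 e (v r.+1 - v r) = det2 e (v r.+1) - det2 e (v r).
    by rewrite /det2 /=; ring.
  by rewrite er er1 subrr oppr0 mulr0 mul0r subrr.
- rewrite -subr_gt0 -(pmulr_rgt0 _ ee).
  have -> : dot e e * (dot (v r.+1 - v r) (gamma k) -
      dot (v r.+1 - v r) (gamma (k + r%:R))) =
    - (dot e (v r.+1) - dot e (v r)) * dot e (v r) -
      (det2 e (v r.+1) - det2 e (v r)) * det2 e (v r).
    by rewrite /v /dot /det2 /=; ring.
  by rewrite er mulr0 subr0 nmulr_lgt0 // oppr_lt0 subr_gt0 (lt_trans dr).
- rewrite -[_ + 1]addrA natr1 -subr_gt0 -(pmulr_rgt0 _ ee).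
  have -> : dot e e * (dot (v r.+1 - v r) (gamma (k + r.+1%:R)) -
      dot (v r.+1 - v r) (gamma k)) =
    (dot e (v r.+1) - dot e (v r)) * dot e (v r.+1) +
      (det2 e (v r.+1) - det2 e (v r)) * det2 e (v r.+1).
    by rewrite /v /dot /det2 /=; ring.
  by rewrite er1 mulr0 addr0 mulr_gt0 // subr_gt0 (lt_trans dr).
Qed.

End ConvexPolygons.

(** * The motion of the midpoints of the halving chords *)

Section CounterclockwiseHalving.
Variables (R : realType) (n : nat).
Variable gamma : 'Z_(2 * n) -> R * R.
Hypothesis n_gt0 : (0 < n)%N.
Hypothesis gamma_inj : injective gamma.
Hypothesis noncollinear :
  exists i j k, det2 (gamma j - gamma i) (gamma k - gamma i) != 0.
Hypothesis gamma_left : forall i j, 0 <= det2 (side gamma i) (gamma j - gamma i).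
Hypothesis halving : forall i,
  area (region gamma `&` left_of_l gamma i) =
  area (region gamma `&` right_of_l gamma i).
Hypothesis delta_neq0 : forall i, delta gamma i != 0.
Implicit Types i k : 'Z_(2 * n).

Lemma region_left_of_side i p :
  region gamma p -> 0 <= det2 (side gamma i) (p - gamma i).
Proof.
move=> Kp.
have -> : det2 (side gamma i) (p - gamma i) =
    det2 (side gamma i) p - det2 (side gamma i) (gamma i) by rewrite /det2 /=; ring.
rewrite subr_ge0; apply: (region_halfplane _ Kp) => j.
rewrite -subr_ge0; have := gamma_left i j; congr (0 <= _).
by rewrite /det2 /=; ring.
Qed.

Lemma opposite_sides_trapezoid i :
  det2 (side gamma i) (gamma (opp i + 1) - gamma i) =
  det2 (side gamma (opp i)) (gamma i - gamma (opp i)).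
Proof.
have [M KM] := region_bounded gamma.
apply: (@halving_trapezoid _ (region gamma) M) => //.
- exact: region_measurable.
- exact: region_convex.
- exact: region_vertex.
- exact: region_vertex.
- exact: region_vertex.
- exact: region_vertex.
- rewrite (inj_eq gamma_inj) /opp -subr_eq0 opprD addrA subrr add0r oppr_eq0.
  by apply: natr_Z_neq0 => //; lia.
- by move=> p; exact: region_left_of_side.
- by move=> p; exact: region_left_of_side.
- exact: delta_neq0.
- exact: halving.
- by have := halving (i + 1); rewrite /left_of_l /right_of_l opp_vertexS.
Qed.

(** Twice the midpoint of the chord through gamma i. *)
Definition chord_sum i := gamma i + gamma (opp i).

(** The midpoint moves parallel to T - P, where P = gamma i and
    T = gamma (i + n + 1), by a factor that has the sign of delta i. The vector
    identity is stated through its determinant with w. *)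
Lemma chord_sum_step (w : R * R) i :
  det2 (side gamma i) (gamma (opp i + 1) - gamma i) *
    det2 w (chord_sum (i + 1) - chord_sum i) =
  delta gamma i * det2 w (gamma (opp i + 1) - gamma i).
Proof.
have := opposite_sides_trapezoid i.
rewrite /chord_sum /delta /side opp_vertexS.
move: (gamma i) (gamma (i + 1)) (gamma (opp i)) (gamma (opp i + 1)) => P Q S T H.
apply/eqP; rewrite -subr_eq0; apply/eqP.
transitivity ((det2 (Q - P) (T - P) - det2 (T - S) (P - S)) * det2 w (Q - P)).
  by rewrite /det2 /=; ring.
by rewrite H subrr mul0r.
Qed.

Lemma no_positive_half_turn_ccw k :
  ~ forall j, (j < n)%N -> 0 < delta gamma (k + j%:R).
Proof.
move=> dpos; pose w := gamma (opp k) - gamma k.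
have t_gt0 j : (j < n)%N ->
    0 < det2 (side gamma (k + j%:R)) (gamma (opp (k + j%:R) + 1) - gamma (k + j%:R)).
  move=> /dpos; set i := k + _.
  have -> : delta gamma i = det2 (side gamma i) (gamma (opp i + 1) - gamma i)
      - det2 (side gamma i) (gamma (opp i) - gamma i).
    by rewrite /delta /side /det2 /=; ring.
  by rewrite subr_gt0; apply: le_lt_trans; exact: gamma_left.
have step j : (j < n)%N ->
    0 <= det2 w (gamma (opp (k + j%:R) + 1) - gamma (k + j%:R)).
  move=> jn.
  have kn : opp k = k + n%:R by [].
  have -> : opp (k + j%:R) + 1 = k + (n + j.+1)%:R.
    by rewrite /opp natrD -natr1 !addrA; congr (_ + _); rewrite addrAC.
  have -> : det2 w (gamma (k + (n + j.+1)%:R) - gamma (k + j%:R)) =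
    det2 w (gamma (k + (n + j.+1)%:R) - gamma k) +
    det2 (gamma (k + j%:R) - gamma k) w by rewrite /det2 /=; ring.
  rewrite /w kn; apply: addr_ge0.
    (* For j + 1 = n the vertex is gamma k itself. *)
    have [jn1|jn1] := eqVneq j.+1 n.
      by rewrite jn1 natrD natr_double0 // addr0 subrr /det2 /= !mulr0 subrr.
    by apply: fan_turns_left => //; lia.
  case: j jn => [|j] jn; last by apply: fan_turns_left => //; lia.
  by rewrite addr0 subrr /det2 /= !mul0r subrr.
have dw_ge0 j : (j < n)%N ->
    0 <= det2 w (chord_sum (k + j%:R + 1) - chord_sum (k + j%:R)).
  move=> jn; rewrite -(pmulr_rge0 _ (t_gt0 _ jn)) chord_sum_step.
  by rewrite mulr_ge0 ?step // ltW // dpos.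
have dw_gt0 : 0 < det2 w (chord_sum (k + 0%:R + 1) - chord_sum (k + 0%:R)).
  rewrite -(pmulr_rgt0 _ (t_gt0 _ n_gt0)) chord_sum_step mulr_gt0 ?dpos //.
  have := t_gt0 _ n_gt0; rewrite opposite_sides_trapezoid addr0; congr (0 < _).
  by rewrite /w /side /det2 /=; ring.
have : \sum_(j < n) det2 w (chord_sum (k + j%:R + 1) - chord_sum (k + j%:R)) = 0.
  have -> : \sum_(j < n) det2 w (chord_sum (k + j%:R + 1) - chord_sum (k + j%:R)) =
     \sum_(0 <= j < n)
       (det2 w (chord_sum (k + j.+1%:R)) - det2 w (chord_sum (k + j%:R))).
    rewrite big_mkord; apply: eq_bigr => j _.
    by rewrite -[k + _ + 1]addrA natr1 /det2 /=; ring.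
  rewrite telescope_sumr // addr0 /chord_sum -/(opp k) opp_vertexK //.
  by rewrite [gamma (opp k) + _]addrC subrr.
apply/eqP; rewrite gt_eqF //.
rewrite (bigD1 (Ordinal n_gt0)) //= ltr_pwDl //.
by apply: sumr_ge0 => j _; exact: dw_ge0 (ltn_ord j).
Qed.

End CounterclockwiseHalving.

(** * Reversal of the orientation *)

Section Reversal.
Variables (R : realType) (n : nat).
Variable gamma : 'Z_(2 * n) -> R * R.
Hypothesis n_gt0 : (0 < n)%N.
Implicit Types i k : 'Z_(2 * n).

Definition reversed i := gamma (- i).

Lemma side_reversed i : side reversed i = - side gamma (- (i + 1)).
Proof. by rewrite /side /reversed opprD addrNK opprB. Qed.

Lemma region_reversed : region reversed = region gamma.
Proof.
apply/seteqP; split=> p [t [t0 t1 ->]]; exists (fun i => t (- i)); split=> //.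
- by rewrite -t1 [RHS](reindex_inj oppr_inj).
- congr pair; rewrite [RHS](reindex_inj oppr_inj);
  by apply: eq_bigr => i _; rewrite /= opprK.
- by rewrite -t1 [RHS](reindex_inj oppr_inj).
- by congr pair; rewrite [LHS](reindex_inj oppr_inj).
Qed.

Lemma left_of_l_reversed i : left_of_l reversed i = left_of_l gamma (- i).
Proof. by rewrite /left_of_l /reversed opp_vertexN. Qed.

Lemma right_of_l_reversed i : right_of_l reversed i = right_of_l gamma (- i).
Proof. by rewrite /right_of_l /reversed opp_vertexN. Qed.

Lemma halving_reversed :
  (forall i, area (region gamma `&` left_of_l gamma i) =
             area (region gamma `&` right_of_l gamma i)) ->
  forall i, area (region reversed `&` left_of_l reversed i) =
            area (region reversed `&` right_of_l reversed i).
Proof.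
move=> half i; rewrite region_reversed left_of_l_reversed right_of_l_reversed.
exact: half.
Qed.

Lemma delta_reversed i : delta reversed i = delta gamma (- (i + 1)).
Proof.
rewrite /delta !side_reversed -opp_vertexS opp_vertexN //.
by rewrite /det2 /=; ring.
Qed.

Lemma reversed_left :
  (forall i j, det2 (side gamma i) (gamma j - gamma i) <= 0) ->
  forall i j, 0 <= det2 (side reversed i) (reversed j - reversed i).
Proof.
move=> gamma_right i j; rewrite side_reversed -oppr_le0.
have := gamma_right (- (i + 1)) (- j); congr (_ <= 0).
rewrite /side /reversed.
have -> : - (i + 1) + 1 = - i by rewrite opprD addrNK.
by rewrite /det2 /=; ring.
Qed.

End Reversal.

Lemma no_positive_half_turn (R : realType) (n : nat)
    (gamma : 'Z_(2 * n) -> R * R) k :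
  (0 < n)%N -> half_area_polygon gamma -> (forall i, delta gamma i != 0) ->
  ~ forall j, (j < n)%N -> 0 < delta gamma (k + j%:R).
Proof.
move=> n_gt0 [[inj nc [ccw|cw]] half] d0 dpos.
  exact: (no_positive_half_turn_ccw n_gt0 inj nc ccw half d0 dpos).
have injr : injective (reversed gamma) by move=> i j /inj /oppr_inj.
have ncr : exists i j l, det2 (reversed gamma j - reversed gamma i)
    (reversed gamma l - reversed gamma i) != 0.
  have [a [b [c abc]]] := nc; exists (- a), (- b), (- c).
  by rewrite /reversed !opprK.
have d0r i : delta (reversed gamma) i != 0 by rewrite delta_reversed.
(* The side that comes j steps after - opp k in the reversed listing is the one
   that comes n - 1 - j steps after k in the given listing. *)
apply: (no_positive_half_turn_ccw n_gt0 injr ncr (reversed_left cw)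
  (halving_reversed n_gt0 half) d0r (k := - opp k)).
move=> j jn; rewrite delta_reversed //.
have -> : - (- opp k + j%:R + 1) = k + (n - j.+1)%:R.
  by rewrite -addrA natr1 opprD opprK natrB // addrA.
by apply: dpos; lia.
Qed.

(** * Counting the sign changes *)

Lemma odd_sum_changes (b : nat -> bool) n :
  odd (\sum_(k < n) (b k (+) b k.+1)) = b 0%N (+) b n.
Proof.
elim: n => [|n IH]; first by rewrite big_ord0 addbb.
by rewrite big_ord_recr /= oddD IH oddb -addbA addKb.
Qed.

Theorem theorem4p8 (R : realType) (n : nat) (n_gt0 : (0 < n)%N)
    (gamma : 'Z_(2 * n) -> R * R) (gammaP : half_area_polygon gamma)
    (no_parallel_opposite_sides : forall i, delta gamma i != 0) :
  odd (nb_half_area_vertices gamma) /\ (3 <= nb_half_area_vertices gamma)%N.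
Proof.
set d0 := no_parallel_opposite_sides.
pose b (m : nat) := delta gamma m%:R < 0.
have bn m : b (m + n)%N = ~~ b m.
  rewrite /b natrD -/(opp _).
  have -> : delta gamma (opp m%:R) = - delta gamma m%:R.
    by rewrite /delta opp_vertexK // /det2; ring.
  by rewrite oppr_lt0 lt_neqAle eq_sym d0 /= leNgt.
have vE m : half_area_vertex gamma m.+1%:R = b m (+) b m.+1.
  by rewrite /half_area_vertex mulr_lt0 !d0 /= /b -natr1 addrK.
set A := [set k : 'I_n | half_area_vertex gamma (k.+1)%:R]%SET.
have nbE : nb_half_area_vertices gamma = #|A| by [].
have oddA : odd #|A|.
  rewrite -sum1_card big_mkcond /=.
  rewrite (eq_bigr (fun k : 'I_n => (b k (+) b k.+1 : nat))).
    rewrite odd_sum_changes; have := bn 0%N; rewrite add0n => ->.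
    by case: (b 0%N).
  by move=> k _; rewrite inE vE; case: (_ (+) _).
rewrite nbE; split=> //.
have [|] := ltnP 2 #|A| => // A2.
have /eqP/cards1P[k0 Ak0] : #|A| = 1%N.
  by move: oddA A2; case: #|A| => [|[|[|?]]].
have change m : (m < n)%N -> m != k0 -> b m.+1 = b m.
  move=> mn mk; have : Ordinal mn \notin A by rewrite Ak0 inE.
  by rewrite inE /= vE; case: (b m); case: (b m.+1).
have const j : (j < n)%N -> b (k0.+1 + j)%N = b k0.+1.
  elim: j => [|j IH] jn; first by rewrite addn0.
  rewrite -IH ?(ltnW jn) // addnS.
  have k0n := ltn_ord k0.
  have [mn|nm] := ltnP (k0.+1 + j) n; first by apply: change => //; lia.
  have -> : (k0.+1 + j = (k0.+1 + j - n) + n)%N by lia.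
  by rewrite -addSn !bn change //; lia.
exfalso; case bk : (b k0.+1); last first.
  apply: (@no_positive_half_turn _ _ _ k0.+1%:R n_gt0 gammaP d0) => j jn.
  rewrite -natrD lt_neqAle eq_sym d0 /= leNgt.
  by have := const j jn; rewrite bk /b => ->.
apply: (@no_positive_half_turn _ _ _ (k0.+1 + n)%:R n_gt0 gammaP d0) => j jn.
rewrite -natrD lt_neqAle eq_sym d0 /= leNgt -/(b _) addnAC bn negbK.
by rewrite (const j jn) bk.
Qed.
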